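(* Let $n$ be a positive integer with $n\le 2000$. Then there do not exist finite groups $G$ and $N$, both of order $n$, such that $G$ is insolvable, $N$ is solvable, and $\mathcal{E}'(G,N)$ is non-empty.
   Context: For a finite group $N$, let $\mathrm{Perm}(N)$ be the group of all permutations of the set $N$. A subgroup $\mathcal{G}\le \mathrm{Perm}(N)$ is regular if the map $\mathcal{G}\to N$, $\sigma\mapsto\sigma(1_N)$, is bijective. Let $\rho:N\to\mathrm{Perm}(N)$, $\rho(\eta)(x)=x\eta^{-1}$. The holomorph of $N$ is $\mathrm{Hol}(N)=\rho(N)\rtimes\mathrm{Aut}(N)\le\mathrm{Perm}(N)$. For a group $G$ with $|G|=|N|$, $\mathcal{E}'(G,N)$ denotes the set of regular subgroups of $\mathrm{Hol}(N)$ isomorphic to $G$. *)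

(* Defs.v *)
From mathcomp Require Import all_boot fingroup perm morphism automorphism commutator nilpotent.
Set Implicit Arguments. Unset Strict Implicit. Unset Printing Implicit Defensive.
Import GroupScope.
Local Open Scope group_scope.

(* A finite group N is represented by a finGroupType nT, with N = [set: nT].
   Perm(N) = {perm nT}. *)

Definition rho (nT : finGroupType) (eta : nT) : {perm nT} :=
  perm (mulIg eta^-1).

Definition Hol (nT : finGroupType) : {set {perm nT}} :=
  (@rho nT @: [set: nT]) * Aut [set: nT].

Definition regular_perm (nT : finGroupType) (H : {set {perm nT}}) : Prop :=
  {in H &, injective (fun s : {perm nT} => s 1)} /\
  (forall x : nT, exists2 s, s \in H & s 1 = x).

Definition Eprime (gT nT : finGroupType) (G : {set gT}) (H : {group {perm nT}}) : Prop :=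
  H \subset Hol nT /\ regular_perm H /\ (H \isog G).

(* Main.v *)
Require Import Defs.
From mathcomp Require Import all_boot fingroup perm morphism automorphism commutator nilpotent.
From mathcomp Require Import action quotient gfunctor cyclic center pgroup sylow maximal.
From mathcomp Require Import integral_char.
Set Implicit Arguments. Unset Strict Implicit. Unset Printing Implicit Defensive.
Import GroupScope.

(* Let G be a regular subgroup of N ><| A, with N solvable, and let B be the
   solvable residual of A.  If M < N is normal and A-invariant, then G :&: M A
   is a smaller instance of the same situation, hence solvable by induction; if
   moreover [N, B] <= M, then M B is normal in N A with solvable quotient, so G
   is solvable.  We may therefore assume [N, B] = N.  By the three subgroups
   lemma, every invariant section of N centralized by B is then central.  Hence
   B acts nontrivially on O_p(N / O_p'(N)) for each prime p dividing |N|: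
   otherwise this Fitting subgroup of the solvable group N / O_p'(N) would be
   central, hence the whole group, giving [N, B] <= O_p'(N) < N.  A perfect
   group acts trivially on groups of order 4, 9 or prime, so the p-part of |N|
   is at least 8, and at least 25 if p is odd.  If G is insolvable, |G| = |N|
   has three prime divisors by Burnside's p^a q^b theorem, whence
   |N| >= 8 * 25 * 25 = 5000. *)

(** * Perfect groups acting on small groups *)

(** Take [B] minimal among normal subgroups with solvable quotient: its derived subgroup is another
    one, so equals [B]. *)
Lemma perfect_residual (gT : finGroupType) (A : {group gT}) :
  exists B : {group gT}, [/\ B <| A, solvable (A / B) & [~: B, B] = B].
Proof.
pose P := [pred B : {group gT} | (B <| A) && solvable (A / B)].
have PA : P A by rewrite /= normal_refl trivg_quotient solvable1.
have [B /mingroupP[/andP[nBA solAB] minB] _] := mingroup_exists PA.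
exists B; split=> //.
have nB'A : B^`(1) <| A := char_normal_trans (der_char 1 B) nBA.
have solAB' : solvable (A / B^`(1)).
  rewrite (series_sol (quotient_normal B^`(1) nBA)).
  rewrite (abelian_sol (der_abelian 0 B)) /=.
  by rewrite -(isog_sol (third_isog (der_sub 1 B) nB'A nBA)) in solAB *.
have PB' : P [group of B^`(1)] by rewrite /= nB'A.
have eqB := minB [group of B^`(1)] PB' (der_sub 1 B).
by rewrite -[RHS]/(gval B) -[in RHS]eqB.
Qed.

Lemma perfect_solvable_quotient (gT : finGroupType) (B H : {group gT}) :
  [~: B, B] = B -> B \subset 'N(H) -> solvable (B / H) -> B \subset H.
Proof.
(* Solvability forbids nontrivial subgroups contained in their own commutator; apply this to [B / H]
   itself. *)
move=> pB nHB /forallP/(_ (B / H)%G); rewrite -quotientR // pB subsetI subxx /=.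
by rewrite -subG1 quotient_sub1.
Qed.

Lemma solvable_pi_group23 (gT : finGroupType) (G : {group gT}) :
  [pred p | p < 5].-group G -> solvable G.
Proof.
move=> piG; apply: Burnside_p_a_q_b.
apply: (@uniq_leq_size _ _ [:: 2; 3] (primes_uniq _)) => p.
rewrite mem_primes => /and3P[pr_p _ pG].
have /= := pgroupP piG p pr_p pG.
by case: p pr_p {pG} => [|[|[|[|[|p]]]]].
Qed.

(** Sylow [r]-subgroups of [B] with [r >= 5] centralize [Y], so [B / 'C(Y)] is a {2,3}-group, hence
    solvable. *)
Lemma perfect_cent_small (gT : finGroupType) (B Y : {group gT}) :
  [~: B, B] = B -> B \subset 'N(Y) -> #|Y| = 4 \/ #|Y| = 9 -> B \subset 'C(Y).
Proof.
move=> pB nYB oY.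
have nCB : B \subset 'N('C(Y)) := subset_trans nYB (cent_norm Y).
apply: perfect_solvable_quotient => //; apply: solvable_pi_group23.
apply/pgroupP=> r pr_r rBC; rewrite inE ltnNge; apply/negP=> r_ge5.
have [S sylS] := Sylow_exists r B.
have sSB := pHall_sub sylS.
have cSY : S \subset 'C(Y).
  have := pgroup_fix_mod (pHall_pgroup sylS) (_ : [acts S, on Y | 'J]).
  rewrite astabsJ (subset_trans sSB nYB) => /(_ isT).
  rewrite afixJ -/('C_Y(S)) => eqm.
  have dvY : #|'C_Y(S)| %| #|Y| by rewrite cardSg ?subsetIl.
  suff: #|'C_Y(S)| == #|Y|.
    rewrite (subset_leqif_cards (subsetIl _ _)) => /eqP eqCY.
    by rewrite centsC -eqCY subsetIr.
  have leY := subset_leq_card (subsetIl Y 'C(S)).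
  move/eqP: eqm; rewrite eqn_mod_dvd // => rd.
  rewrite eqn_leq leY -subn_eq0; case: posnP => // d_gt0.
  (* As [c] divides 4 or 9, the nonzero differences are 2, 3, 6 and 8. *)
  have /allP/(_ r): all (gtn 5) (primes (#|Y| - #|'C_Y(S)|)).
    move: dvY leY d_gt0; move: #|'C_Y(S)| => c; case: oY => ->;
    by case: c => [|[|[|[|[|[|[|[|[|[|c]]]]]]]]]].
  by rewrite mem_primes pr_r d_gt0 rd => /(_ isT) /=; rewrite ltnNge r_ge5.
have sylSC : r.-Sylow(B / 'C(Y)) (S / 'C(Y)).
  by apply: quotient_pHall => //; apply: subset_trans sSB nCB.
have := card_Hall sylSC; rewrite /= quotientS1 // cards1 => /esym/eqP.
by rewrite p_part_eq1 mem_primes pr_r cardG_gt0 rBC.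
Qed.

Lemma perfect_cent_prime (gT : finGroupType) (B Y : {group gT}) :
  [~: B, B] = B -> B \subset 'N(Y) -> prime #|Y| -> B \subset 'C(Y).
Proof.
move=> pB nYB prY.
have cAut : abelian (Aut Y) := Aut_cyclic_abelian (prime_cyclic prY).
rewrite -ker_conj_aut ker_trivg_morphim nYB /= -[in _ @* _]pB morphimR //.
by rewrite subG1; apply/eqP/commG1P; apply: abelianS cAut; apply: Aut_conj_aut.
Qed.

(** Orders 1, [p], 4 and 9 are excluded, so [#|Y|] is at least 8, 27 or 25 according as [p = 2],
    [p = 3] or [p >= 5]. *)
Lemma perfect_noncentral_card (gT : finGroupType) p (B Y : {group gT}) :
  prime p -> p.-group Y -> [~: B, B] = B -> B \subset 'N(Y) ->
  ~~ (B \subset 'C(Y)) -> 8 <= #|Y| /\ (odd p -> 25 <= #|Y|).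
Proof.
move=> pr_p pY pB nYB ncY.
have [t oY] := p_natP pY.
have {pY}nt : 1 < t.
  rewrite ltnNge; apply/negP=> let1; case/negP: ncY.
  case: t let1 oY => [|[|//]] _ oY.
    by move/card1_trivg: oY => ->; rewrite centsC sub1G.
  by apply: perfect_cent_prime; rewrite // oY expn1.
have n4 : #|Y| != 4.
  by apply: contraNneq ncY => o4; apply: perfect_cent_small; auto.
have n9 : #|Y| != 9.
  by apply: contraNneq ncY => o9; apply: perfect_cent_small; auto.
move: n4 n9; rewrite oY; clear oY ncY.
have [-> | [-> | p5]] : p = 2 \/ p = 3 \/ 5 <= p.
- by case: p pr_p => [|[|[|[|[|p]]]]] //; auto.
- case: t nt => [|[|[|t]]] // _ _ _; split=> //.
  exact: (@leq_pexp2l 2 3 t.+3).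
- case: t nt => [|[|[|t]]] // _ _ _.
  have le27 : (27 <= 3 ^ t.+3)%N := @leq_pexp2l 3 3 t.+3 isT isT.
  by split=> [|_]; apply: leq_trans le27.
move=> _ _; have le25 : (25 <= p ^ t)%N.
  apply: (@leq_trans (p ^ 2)%N); first by rewrite -[25]/(5 ^ 2)%N leq_exp2r.
  by rewrite leq_exp2l // prime_gt1.
by split=> [|_]; apply: leq_trans le25.
Qed.

(** * Fitting subgroups and lower bounds on p-parts *)

(** The preimage [X] of the Fitting subgroup of [G / 'F(G)] is nilpotent, being so modulo its
    center, hence lies in ['F(G)]. *)
Lemma central_Fitting (gT : finGroupType) (G : {group gT}) :
  solvable G -> G \subset 'C('F(G)) -> 'F(G) = G.
Proof.
move=> solG cFG; have nFG := Fitting_normal G.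
suff: G / 'F(G) == 1.
  rewrite -subG1 quotient_sub1 ?normal_norm // => sGF.
  by apply/eqP; rewrite eqEsubset Fitting_sub.
rewrite -trivg_Fitting ?quotient_sol // -subG1.
have [X defX sFX nXG] := inv_quotientN nFG (Fitting_normal (G / 'F(G))).
have nFX := subset_trans (normal_sub nXG) (normal_norm nFG).
rewrite defX quotient_sub1 //.
apply: (Fitting_max nXG).
have sFZ : 'F(G) \subset 'Z(X).
  by rewrite subsetI sFX centsC (subset_trans (normal_sub nXG)).
rewrite -quotient_center_nil.
have nZX := normal_norm (center_normal X).
have /homgP[f <-] := homg_quotientS nFX nZX sFZ.
by rewrite morphim_nil //= -defX Fitting_nil.
Qed.

Lemma commg_perfect_card_p_part (gT : finGroupType) p (R B : {group gT}) :
  solvable R -> B \subset 'N(R) -> [~: B, B] = B -> [~: R, B] = R ->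
  p \in primes #|R| -> (8 <= #|R|`_p)%N /\ (odd p -> (25 <= #|R|`_p)%N).
Proof.
move=> solR nRB pB RB; rewrite mem_primes => /and3P[pr_p _ pR].
pose K := 'O_p^'(R)%G.
have nKR : R \subset 'N(K) := normal_norm (pcore_normal p^' R).
have nKB : B \subset 'N(K) by apply: gFnorm_trans.
pose Y := 'O_p(R / K)%G.
have nYR : R / K \subset 'N(Y) := normal_norm (pcore_normal p (R / K)).
have nRBb : B / K \subset 'N(R / K) by apply: quotient_norms.
have nYB : B / K \subset 'N(Y) by apply: gFnorm_trans.
have pBb : [~: B / K, B / K] = B / K by rewrite -quotientR ?pB.
have RBb : [~: R / K, B / K] = R / K by rewrite -quotientR ?RB.
have ncY : ~~ (B / K \subset 'C(Y)).
  apply/negP=> cYB.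
  have BY : [~: B / K, Y] = 1 by apply/commG1P.
  have cYR : R / K \subset 'C(Y).
    apply/commG1P; rewrite -RBb; apply: three_subgroup.
      by rewrite BY comm1G.
    by apply/commG1P; rewrite (@subset_trans _ _ Y) ?commg_subl // centsC.
  have FY : 'F(R / K) = Y.
    by apply: Fitting_eq_pcore; apply: trivg_pcore_quotient.
  have YR : Y = R / K :> {set _}.
    by rewrite -FY central_Fitting ?quotient_sol ?FY.
  (* Now [R / K] is trivial, so [R] is a p'-group although [p] divides its order. *)
  have : R / K \subset [1 coset_of K] by rewrite -RBb -YR commGC BY.
  rewrite quotient_sub1 // => sRK.
  have := pnat_dvd pR (pgroupS sRK (pcore_pgroup _ _)).
  by rewrite p'natE // dvdnn.
have [Y8 Y25] := perfect_noncentral_card pr_p (pcore_pgroup p _) pBb nYB ncY.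
have leY : #|Y| <= #|R|`_p.
  apply: dvdn_leq; first exact: part_gt0.
  rewrite -(part_pnat_id (pcore_pgroup p (R / K))); apply: partn_dvd => //.
  by apply: dvdn_trans (cardSg (pcore_sub _ _)) (dvdn_quotient _ _).
by split=> [|/Y25 ?]; apply: leq_trans leY.
Qed.

Lemma three_p_parts_leq n : 2 < size (primes n) ->
    {in primes n, forall p : nat, (8 <= n`_p)%N /\ (odd p -> (25 <= n`_p)%N)} ->
  (5000 <= n)%N.
Proof.
have := sorted_primes n; have := mem_primes^~ n.
case: (primes n) => [|p [|q [|r s]]] // mem_s /= /and3P[ltpq ltqr _] _ bnd.
have [/and3P[pr_p n_gt0 _] /and3P[pr_q _ _] /and3P[pr_r _ _]] :
    [/\ [&& prime p, 0 < n & p %| n], [&& prime q, 0 < n & q %| n]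
      & [&& prime r, 0 < n & r %| n]].
  by rewrite -!mem_s !inE !eqxx !orbT.
have odd_gt2 x : prime x -> 2 < x -> odd x.
  by move=> pr_x; case: (even_prime pr_x) => [->|].
(* Only the least of the three primes can be 2. *)
have q2 : 2 < q := leq_ltn_trans (prime_gt1 pr_p) ltpq.
have [p8 _] := bnd p (mem_head _ _).
have q25 : (25 <= n`_q)%N.
  have [|_ -> //] := bnd q; first by rewrite !inE eqxx orbT.
  exact: odd_gt2.
have r25 : (25 <= n`_r)%N.
  have [|_ -> //] := bnd r; first by rewrite !inE eqxx !orbT.
  exact: odd_gt2 (ltn_trans q2 ltqr).
have co x y : prime x -> x < y -> prime y -> coprime n`_x n`_y.
  move=> pr_x ltxy pr_y; rewrite !p_part coprimeXl ?coprimeXr //.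
  by rewrite prime_coprime // dvdn_prime2 // neq_ltn ltxy.
have dv : n`_p * n`_q * n`_r %| n.
  by rewrite !Gauss_dvd ?coprimeMl ?co ?dvdn_part // (ltn_trans ltpq).
apply: leq_trans (dvdn_leq n_gt0 dv).
by rewrite (@leq_mul 200 25) // (@leq_mul 8 25).
Qed.

(** * Regular subgroups of split extensions *)

(* [G] acts regularly on [R], viewed as the coset space [(R * A) / A]: the
   stabilizer of the base point is [G :&: A]. *)
Definition split_regular (gT : finGroupType) (R A G : {group gT}) :=
  [/\ A \subset 'N(R), R :&: A = 1, G \subset R * A, #|G| = #|R| & G :&: A = 1].

Lemma split_regular_mulG (gT : finGroupType) (R A G : {group gT}) :
  split_regular R A G -> G * A = R * A.
Proof.
case=> nRA tiRA sG oG tiGA; apply/eqP.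
have sGA : G * A \subset R * A by rewrite -{2}(mulGid A) mulgA mulSg.
by rewrite eqEcard sGA !TI_cardMg // oG /=.
Qed.

(** By Dedekind's law the new group times [A] is [M * A]; cancelling [#|A|] gives its order. *)
Lemma split_regular_sub (gT : finGroupType) (R A G M : {group gT}) :
  split_regular R A G -> M \subset R -> A \subset 'N(M) ->
  split_regular M A (G :&: (M <*> A))%G.
Proof.
move=> srG sMR nMA; have GA := split_regular_mulG srG.
case: srG => nRA tiRA sG oG tiGA.
have tiMA : M :&: A = 1 by apply/trivgP; rewrite -tiRA setSI.
have tiHA : G :&: (M <*> A) :&: A = 1.
  by apply/trivgP; rewrite -tiGA setSI ?subsetIl.
split=> //=; first by rewrite -norm_joinEr // subsetIr.
apply/eqP; rewrite -(eqn_pmul2r (cardG_gt0 A)) -!TI_cardMg //=.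
rewrite setIC group_modr ?joing_subr // GA /= norm_joinEr //.
by rewrite (setIidPl (mulSg _ sMR)).
Qed.

Lemma split_regular_solvable (gT : finGroupType) (R A G B M : {group gT}) :
    split_regular R A G -> solvable R -> B <| A -> solvable (A / B) ->
    M <| R -> A \subset 'N(M) -> [~: R, B] \subset M ->
  solvable (G :&: (M <*> A)) -> solvable G.
Proof.
case=> nRA _ sG _ _ solR /andP[sBA nBA] solAB /andP[sMR nMR] nMA RB solH.
have nMB := subset_trans sBA nMA.
pose L := (M <*> B)%G.
have nLA : A \subset 'N(L) by rewrite normsY.
have nLR : R \subset 'N(L).
  (* A conjugate of [b] by [x] is [b] times a commutator lying in [M]. *)
  apply/subsetP=> x Rx; rewrite inE conjYg join_subG (normsP nMR) // joing_subl.
  apply/subsetP=> _ /imsetP[b Bb ->]; rewrite conjg_mulR groupM //.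
    by rewrite (subsetP (joing_subr M B)).
  by rewrite (subsetP (joing_subl M B)) // (subsetP RB) // commGC mem_commg.
have nLG : G \subset 'N(L).
  by apply: subset_trans sG _; rewrite -norm_joinEr // join_subG nLR.
have sBL : B \subset L := joing_subr M B.
have sLMA : L \subset M <*> A by rewrite genS ?setUS.
clearbody L; have solAL : solvable (A / L).
  by have /homgP[f <-] := homg_quotientS nBA nLA sBL; apply: morphim_sol.
have solG : solvable (G / L).
  apply: solvableS (_ : _ \subset (R <*> A) / L) _.
    by rewrite quotientS //= norm_joinEr.
  have nRW : R / L <| (R <*> A) / L by rewrite quotient_normal // normalYl.
  rewrite (series_sol nRW) (quotient_sol L solR) /=.
  have -> : (R <*> A) / L = R / L * (A / L).
    by rewrite norm_joinEr // quotientMl.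
  by rewrite quotientMidl quotient_sol.
have nLG' : L :&: G <| G by rewrite /normal subsetIr normsI ?normG.
(* [G] is an extension of [L :&: G], inside [G :&: (M <*> A)], by a copy of [G / L]. *)
rewrite (series_sol nLG') (isog_sol (second_isog nLG)) solG andbT /=.
by apply: solvableS solH; rewrite /= setIC setIS.
Qed.

Lemma split_regular_small_solvable (gT : finGroupType) (R A G : {group gT}) :
  split_regular R A G -> solvable R -> #|R| < 5000 -> solvable G.
Proof.
have [m] := ubnP #|R|; elim: m => // m IHm in R A G *.
rewrite ltnS => leRm srG solR ltR.
have [B [nBA solAB pB]] := perfect_residual A.
have [nRA tiRA sG oG tiGA] := srG.
have step (M : {group gT}) : M <| R -> A \subset 'N(M) -> [~: R, B] \subset M ->
    M \proper R -> solvable G.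
  move=> nMR nMA RB ltMR; have ltM := proper_card ltMR.
  have srH := split_regular_sub srG (normal_sub nMR) nMA.
  apply: (split_regular_solvable srG solR nBA solAB nMR nMA RB).
  apply: IHm srH _ _; first exact: leq_trans ltM leRm.
    exact: solvableS (normal_sub nMR) solR.
  exact: ltn_trans ltM ltR.
have nRB : B \subset 'N(R) := subset_trans (normal_sub nBA) nRA.
have [RB | neRB] := eqVneq [~: R, B] R; last first.
  apply: (step [~: R, B]%G) => //=.
  - by rewrite /normal commg_subl nRB commg_norml.
  - by rewrite normsR // normal_norm.
  - by rewrite properEneq neRB commg_subl.
apply: Burnside_p_a_q_b; rewrite oG leqNgt; apply/negP=> gt2.
suff : (5000 <= #|R|)%N by rewrite leqNgt ltR.
apply: three_p_parts_leq gt2 _ => p.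
exact: (commg_perfect_card_p_part solR nRB pB RB).
Qed.

(** * The holomorph as a split extension *)

Section RightTranslations.
Variable nT : finGroupType.

Lemma rhoE (eta x : nT) : rho eta x = x * eta^-1.
Proof. by rewrite permE. Qed.

Lemma rho_inj : injective (@rho nT).
Proof. by move=> a b /permP/(_ 1); rewrite !rhoE !mul1g => /invg_inj. Qed.

(* [rho] reverses products, because permutations compose from left to right;
   inverting its argument gives a morphism with the same image. *)
Definition rtrans (eta : nT) := rho eta^-1.

Lemma rtransM : {in [set: nT] &, {morph rtrans : a b / a * b}}.
Proof.
by move=> a b _ _; apply/permP=> x; rewrite permM !rhoE !invgK mulgA.
Qed.

Canonical rtrans_morphism := Morphism rtransM.

Lemma im_rtrans : rtrans @* [set: nT] = @rho nT @: [set: nT].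
Proof.
rewrite morphimEdom; apply/setP=> s.
by apply/imsetP/imsetP=> -[a _ ->]; exists a^-1; rewrite ?inE //= /rtrans ?invgK.
Qed.

Lemma regular_perm_split (H : {group {perm nT}}) :
    H \subset Hol nT -> regular_perm H ->
  split_regular (rtrans @* [set: nT]) (Aut_group [set: nT]) H.
Proof.
move=> sHol [injH surjH]; split; rewrite /= ?im_rtrans //.
- apply/subsetP=> a Aa; rewrite inE.
  apply/subsetP=> _ /imsetP[_ /imsetP[x _ ->] ->].
  (* Conjugating [rho x] by the automorphism [a] gives [rho (a x)]. *)
  apply/imsetP; exists (a x); rewrite ?inE //; apply/permP=> y.
  rewrite conjgE !permM !rhoE.
  have aM : {morph a : u v / u * v}.
    by move=> u v; apply: (morphicP (Aut_morphic Aa)); rewrite inE.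
  have aV : a x^-1 = (a x)^-1 by rewrite -(autmE Aa) morphV ?inE.
  by rewrite aM aV permKV.
- rewrite -im_rtrans; apply/trivgP/subsetP=> s /setIP[sR].
  have /imsetP[x _ ->] : s \in @rho nT @: [set: nT] by rewrite -im_rtrans.
  move=> As; rewrite inE; apply/eqP/permP=> y.
  have : rho x 1 = 1 by rewrite -(autmE As) morph1.
  by rewrite rhoE perm1 mul1g rhoE => ->; rewrite mulg1.
- rewrite (card_imset _ rho_inj) -(card_in_imset injH).
  apply: eq_card => x; rewrite in_setT; apply/imsetP.
  by have [s Hs <-] := surjH x; exists s.
(* Automorphisms fix 1, and by regularity only the identity of [H] does. *)
- apply/trivgP/subsetP=> s /setIP[Hs As]; rewrite inE; apply/eqP/injH => //.
  by rewrite perm1 -{1}(autmE As) morph1.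
Qed.

End RightTranslations.

Theorem theorem1p10 (n : nat) : 0 < n -> n <= 2000 ->
  forall (gT nT : finGroupType),
    #|[set: gT]| = n -> #|[set: nT]| = n ->
    ~~ solvable [set: gT] -> solvable [set: nT] ->
    ~ exists H : {group {perm nT}}, Eprime [set: gT] H.
Proof.
move=> _ le2000 gT nT _ oN nsolG solN [H [sHol [regH isoHG]]].
case/negP: nsolG; rewrite -(isog_sol isoHG).
apply: (split_regular_small_solvable (regular_perm_split sHol regH)).
  exact: morphim_sol.
apply: leq_ltn_trans (leq_morphim _ _) _; rewrite oN.
by apply: leq_ltn_trans le2000 _.
Qed.
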